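(* Let $\mu$ be a signed charge on a semi-ring $\mathcal{S}$ of subsets of a set $\Omega$, with $\mu>-\infty$ (i.e. $\mu(A)>-\infty$ for all $A\in\mathcal{S}$). The charges $\mu^+:=\mu\vee 0$ and $\mu^-:=(-\mu)\vee 0$ satisfy $$\mu^+=\mu+\mu^-,\qquad |\mu|=\mu^++\mu^-.$$ If $\mu$ is a signed measure, then $\mu^+$ and $\mu^-$ are measures.
   Context: A semi-ring $\mathcal{S}$ of subsets of $\Omega$ is a family with $\emptyset\in\mathcal{S}$, closed under finite intersections, and such that for $A,B\in\mathcal{S}$ the set $A\setminus B$ is a finite disjoint union of elements of $\mathcal{S}$. $\mathscr{P}(A)$ denotes the family of all finite partitions of $A$ by elements of $\mathcal{S}$. A signed charge on $\mathcal{S}$ is a set function $\mu:\mathcal{S}\to[-\infty,\infty]$ with $\mu(\emptyset)=0$ that avoids at least one of the values $+\infty,-\infty$ and is finitely additive (for finite families of pairwise disjoint elements of $\mathcal{S}$ whose union is in $\mathcal{S}$); a charge is a non-negative signed charge (possibly taking the value $+\infty$). A (signed) measure is a countably additive (signed) charge. For signed charges $\mu,\nu$ with $\max\{\mu(A),\nu(A)\}>-\infty$ for all $A\in\mathcal{S}$, $(\mu\vee\nu)(A)=\sup_{\Pi\in\mathscr{P}(A)}\sum_{C\in\Pi}\max\{\mu(C),\nu(C)\}$, which is the least upper bound of $\{\mu,\nu\}$ among signed charges for the pointwise order. The variation is $|\mu|:=\mu\vee(-\mu)$. *)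

(* Defs.v *)
From HB Require Import structures.
From mathcomp Require Import all_boot all_order all_algebra.
From mathcomp Require Import all_classical all_reals all_analysis.

Set Implicit Arguments.
Unset Strict Implicit.
Unset Printing Implicit Defensive.
Import Order.TTheory GRing.Theory Num.Theory.
Import numFieldNormedType.Exports.

Local Open Scope classical_set_scope.
Local Open Scope ring_scope.
Local Open Scope ereal_scope.

(* The ground set is an arbitrary type: [semiRingOfSetsType] would require it
   to be pointed, hence nonempty. *)
Definition is_semiring_of_sets (Omega : Type) (S : set (set Omega)) : Prop :=
  [/\ S set0, setI_closed S & semi_setD_closed S].

(* Set functions on [S] are represented by functions on all subsets of [Omega];
   only their values on members of [S] are meaningful. *)
Section SetFunctions.
Context (R : realType) (Omega : Type) (S : set (set Omega)).
Implicit Types (mu nu : set Omega -> \bar R) (A : set Omega).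

Definition finitely_additive mu : Prop :=
  forall (n : nat) (F : 'I_n -> set Omega),
    (forall i, S (F i)) -> trivIset setT F -> S (\bigcup_i F i) ->
    mu (\bigcup_i F i) = \sum_(i < n) mu (F i).

Definition countably_additive mu : Prop :=
  forall F : nat -> set Omega,
    (forall i, S (F i)) -> trivIset setT F -> S (\bigcup_i F i) ->
    (fun n => \sum_(0 <= i < n) mu (F i)) @ \oo --> mu (\bigcup_i F i).

Definition is_signed_charge mu : Prop :=
  [/\ mu set0 = 0,
      (forall A, S A -> mu A != +oo) \/ (forall A, S A -> mu A != -oo) &
      finitely_additive mu].

Definition is_charge mu : Prop :=
  is_signed_charge mu /\ forall A, S A -> 0 <= mu A.

Definition is_signed_measure mu : Prop :=
  is_signed_charge mu /\ countably_additive mu.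

Definition is_measure mu : Prop := is_charge mu /\ countably_additive mu.

(* Blocks are required to be nonempty by the library's [partition]; this does
   not affect [charge_join] below, since charges vanish at the empty set. *)
Definition finite_partitions A : set (set (set Omega)) :=
  [set P | [/\ finite_set P, P `<=` S & partition P id A]].

Definition charge_join mu nu A : \bar R :=
  ereal_sup [set \sum_(C \in P) maxe (mu C) (nu C) | P in finite_partitions A].

Definition charge_pos mu : set Omega -> \bar R := charge_join mu (cst 0).

Definition charge_neg mu : set Omega -> \bar R :=
  charge_join (fun A => - mu A) (cst 0).

Definition charge_abs mu : set Omega -> \bar R :=
  charge_join mu (fun A => - mu A).

End SetFunctions.

(* Main.v *)
Require Import Defs.
From mathcomp Require Import all_boot all_order all_algebra.
From mathcomp Require Import all_classical all_reals all_analysis.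

Set Implicit Arguments.
Unset Strict Implicit.
Unset Printing Implicit Defensive.
Import Order.TTheory GRing.Theory Num.Theory.
Import numFieldNormedType.Exports.

Local Open Scope classical_set_scope.
Local Open Scope ring_scope.
Local Open Scope ereal_scope.

(** Everything rests on one construction.  Let [f] be a nonnegative set function
    with [f set0 = 0], and let [v A] be the supremum of [\sum_(C in P) f C] over
    the finite partitions [P] of [A] by members of [S].  Gluing partitions of
    disjoint sets shows that [v] is superadditive
    ([partition_sup_superD], [partition_sup_super_seq]).  If [f] is subadditive,
    refining a partition can only increase its sum, and cutting the blocks of a
    partition of a union along the members of the union shows that [v] is
    subadditive too.  Hence [v] is finitely additive, and countably additive when
    [f] is countably subadditive ([partition_sup_additive],
    [partition_sup_sigma_additive]).

    The positive part [f C = maxe (mu C) 0] of an additive function is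
    subadditive, and [v] is then [charge_pos S mu]; the negative part is the
    positive part of [- mu], which is still additive because [mu] avoids [-oo].
    So both are charges, and measures when [mu] is countably additive.

    The two identities hold for every single extended real [x > -oo]:
    [max(x, 0) = x + max(-x, 0)] and [|x| = max(x, 0) + max(-x, 0)].  Summed over
    a partition of [A], the first one says that the sums defining
    [charge_pos S mu A] and [charge_neg S mu A] differ by the constant [mu A],
    and so do the suprema ([charge_pos_addE]).  For the second one, a supremum of
    sums is the sum of the suprema because two partitions of [A] have a common
    refinement, along which both sums increase ([charge_abs_addE]). *)

(** * Suprema of sums and positive parts in the extended reals *)

(** Subtracting a fixed [y] reduces the claim to the definition of a supremum,
    which is possible once everything is finite.  If one of the sets is empty
    the left-hand side is [-oo]; otherwise nonnegativity forces all terms, and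
    both suprema, to be finite as soon as [c] is. *)
Lemma ge_ereal_supD (R : realType) (X Y : set (\bar R)) (c : \bar R) :
  (forall x, X x -> 0 <= x) -> (forall y, Y y -> 0 <= y) ->
  (forall x y, X x -> Y y -> x + y <= c) -> ereal_sup X + ereal_sup Y <= c.
Proof.
move=> X0 Y0 XYc.
have [->|/set0P [x0 Xx0]] := eqVneq X set0; first by rewrite ereal_sup0 addNye leNye.
have [->|/set0P [y0 Yy0]] := eqVneq Y set0; first by rewrite ereal_sup0 addeNy leNye.
have c0 : 0 <= c.
  by apply: le_trans (XYc _ _ Xx0 Yy0); apply: adde_ge0; [exact: X0|exact: Y0].
case: c XYc c0 => [r| |] // XYc c0; last by rewrite leey.
have fin x y : X x -> Y y -> x \is a fin_num /\ y \is a fin_num.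
  move=> Xx Yy; move: (X0 _ Xx) (Y0 _ Yy) (XYc _ _ Xx Yy).
  by case: x {Xx} => [x| |] //; case: y {Yy} => [y| |].
have Xsup y : Y y -> ereal_sup X + y <= r%:E.
  move=> Yy; have [_ yfin] := fin _ _ Xx0 Yy.
  rewrite -leeBrDr//; apply: ge_ereal_sup => x Xx.
  by rewrite leeBrDr//; exact: XYc.
have sX0 : 0 <= ereal_sup X.
  by apply: le_trans (ereal_sup_ubound Xx0); exact: X0.
have sXfin : ereal_sup X \is a fin_num.
  move: (Xsup _ Yy0) (Y0 _ Yy0) sX0.
  by case: (ereal_sup X) => [x| |] //; case: y0 {Yy0} => [y| |].
rewrite -leeBrDl//; apply: ge_ereal_sup => y Yy.
by rewrite leeBrDl//; exact: Xsup.
Qed.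

(** The case [x = +oo] is harmless: the negative part is then [0].  For
    [x = -oo] the right-hand side would be [-oo + +oo]. *)
Lemma maxe0_addN (R : realType) (x : \bar R) : -oo < x -> maxe x 0 = x + maxe (- x) 0.
Proof.
case: x => [r| |]// _; last by rewrite maxye maxNye addye.
rewrite -EFinN -!EFin_max -EFinD; congr EFin.
by rewrite addr_maxr subrr addr0 maxC.
Qed.

Lemma maxeN_maxe0 (R : realType) (x : \bar R) : maxe x (- x) = maxe x 0 + maxe (- x) 0.
Proof.
case: x => [r| |]; last 2 first.
- by rewrite maxye maxNye maxye addye.
- by rewrite /= maxey !maxNye maxye add0e.
rewrite -EFinN -!EFin_max -EFinD; congr EFin.
have [r0|r0] := leP 0%R r.
  rewrite [Num.max (- r)%R _]max_r ?oppr_le0// addr0 max_l//.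
  by rewrite (le_trans _ r0)// oppr_le0.
rewrite [Num.max (- r)%R 0%R]max_l ?oppr_ge0 ?ltW// add0r max_r//.
by rewrite (le_trans (ltW r0))// oppr_ge0 ltW.
Qed.

(** * Indexed partitions *)

Section Splittings.
Context (R : realType) (Omega : Type) (S : set (set Omega)).
Implicit Types (A B : set Omega) (f : set Omega -> \bar R).

(** Finite partitions indexed by a finite type, with empty blocks allowed: these
    are stable under intersection with a set, products and disjoint sums of
    index types, where partitions given as sets of nonempty blocks would need
    their empty or repeated blocks removed each time. *)
Definition splits (I : finType) (G : I -> set Omega) A :=
  [/\ forall i, S (G i), trivIset setT G & \bigcup_i G i = A].

(** [charge_join S mu nu] is by definition the instance where [f] is the
    pointwise maximum of [mu] and [nu]. *)
Definition partition_sup f A : \bar R :=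
  ereal_sup [set \sum_(C \in P) f C | P in finite_partitions S A].

Lemma partition_splits A P : finite_partitions S A P ->
  exists (n : nat) (G : 'I_n -> set Omega), splits G A /\
    forall f, \sum_(C \in P) f C = \sum_(i < n) f (G i).
Proof.
move=> [finP PS [coverP trivP _]].
pose s := finmap.enum_fset (fset_set P).
have sP C : (C \in s) = (C \in P) by rewrite /s in_fset_set.
exists (size s), (fun i => nth set0 s i); split.
  split.
  - by move=> i; apply/PS/set_mem; rewrite -sP mem_nth.
  - move=> i j _ _ /trivP ij; apply/val_inj/eqP.
    rewrite -(nth_uniq set0 (ltn_ord i) (ltn_ord j) (finmap.fset_uniq _)).
    by apply/eqP/ij; apply/set_mem; rewrite -sP mem_nth.
  - rewrite -coverP; apply/seteqP; split=> w.
      by move=> [i _ Gw]; exists (nth set0 s i) => //; apply/set_mem; rewrite -sP mem_nth.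
    move=> [C PC Cw]; have Cs : C \in s by rewrite sP; exact/mem_set.
    have iC : (index C s < size s)%N by rewrite index_mem.
    by exists (Ordinal iC) => //=; rewrite nth_index.
by move=> f; rewrite fsbig_finite//= (big_nth set0) big_mkord.
Qed.

(** The blocks to keep are the nonempty ones; disjointness makes the family
    injective on their indices, and the discarded terms vanish since
    [f set0 = 0]. *)
Lemma splits_partition (I : finType) (G : I -> set Omega) A f :
  f set0 = 0 -> splits G A ->
  exists2 P, finite_partitions S A P & \sum_(C \in P) f C = \sum_i f (G i).
Proof.
move=> f0 [SG trivG UG]; pose D := [set i | G i !=set0].
have injG : set_inj D G.
  move=> i j _ /set_mem [w Gw] Gij; apply: trivG => //.
  by exists w; rewrite Gij.
exists (G @` D).
  split; first exact/finite_image/finite_finset.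
    by move=> _ [i _ <-].
  split.
  - rewrite /cover bigcup_image -UG; apply/seteqP; split=> w [i _ Gw]; exists i => //.
    by exists w.
  - by move=> _ _ [i _ <-] [j _ <-] /trivG ->.
  - by move=> _ [i Di <-].
rewrite fsbig_image// -[RHS]big_enum [RHS]fsbig_seq ?enum_uniq//.
apply: fsbig_widen; first by move=> i _; rewrite /= mem_enum.
move=> i [_ /= nDi]; suff -> : G i = set0 by [].
by apply: contrapT => /eqP/set0P.
Qed.

Lemma splits_le_partition_sup (I : finType) (G : I -> set Omega) A f :
  f set0 = 0 -> splits G A -> \sum_i f (G i) <= partition_sup f A.
Proof.
move=> f0 /(splits_partition f0) [P AP <-].
by apply: ereal_sup_ubound; exists P.
Qed.

Lemma partition_sup_le A f c :
  (forall n (G : 'I_n -> set Omega), splits G A -> \sum_(i < n) f (G i) <= c) ->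
  partition_sup f A <= c.
Proof.
move=> fc; apply: ge_ereal_sup => _ [P /partition_splits [n [G [GA fE]]] <-].
by rewrite fE; exact: fc.
Qed.

Lemma splits1 A : S A -> splits (fun=> A : set Omega) A (I := 'I_1).
Proof.
move=> SA; split=> //; first by move=> i j _ _ _; rewrite !ord1.
by apply/seteqP; split=> [w []//|w Aw]; exists ord0.
Qed.

Lemma splits_sumtype (I J : finType) (G : I -> set Omega) (H : J -> set Omega)
    A B : A `&` B = set0 -> splits G A -> splits H B ->
  splits (fun k : I + J => match k with inl i => G i | inr j => H j end)
    (A `|` B).
Proof.
move=> AB0 [SG tG UG] [SH tH UH]; split.
- by case.
- have noAB w : ~ (A w /\ B w) by move=> ABw; have : (A `&` B) w by []; rewrite AB0.
  case=> [i|i] [j|j] _ _ [w [/= w1 w2]].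
  + by congr inl; apply: tG => //; exists w.
  + by exfalso; apply: (noAB w); split; [rewrite -UG; exists i|rewrite -UH; exists j].
  + by exfalso; apply: (noAB w); split; [rewrite -UG; exists j|rewrite -UH; exists i].
  + by congr inr; apply: tH => //; exists w.
- apply/seteqP; split=> w.
    by case=> [[i|i] _ /= Gw]; [left; rewrite -UG; exists i|right; rewrite -UH; exists i].
  by case; rewrite -?UG -?UH => -[i _ Gw]; [exists (inl i)|exists (inr i)].
Qed.

Lemma splits_refine (I J : finType) (G : I -> set Omega) (H : J -> set Omega) A :
  setI_closed S -> splits G A -> splits H A ->
  splits (fun k : I * J => G k.1 `&` H k.2) A.
Proof.
move=> SI [SG tG UG] [SH tH UH]; split.
- by move=> k; exact: SI.
- move=> [i j] [i' j'] _ _ [w [/= [Gi Hj] [Gi' Hj']]].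
  by congr pair; [apply: tG|apply: tH] => //; exists w.
- apply/seteqP; split=> w.
    by move=> [k _ [Gk _]]; rewrite -UG; exists k.1.
  move=> Aw; move: (Aw); rewrite -{1}UG => -[i _ Gi].
  by move: Aw; rewrite -{1}UH => -[j _ Hj]; exists (i, j).
Qed.

Lemma splitsI (I : finType) (G : I -> set Omega) A B :
  setI_closed S -> splits G A -> S B -> B `<=` A ->
  splits (fun i => B `&` G i) B.
Proof.
move=> SI [SG tG UG] SB BA; split.
- by move=> i; exact: SI.
- exact: trivIset_setIl.
- by rewrite -setI_bigcupr UG; exact: setIidl.
Qed.

(** The definition speaks of families indexed by ['I_n]; an enumeration of [I]
    transports it to any finite index type, in particular to products. *)
Lemma finitely_additive_splits f (I : finType) (G : I -> set Omega) A :
  finitely_additive S f -> S A -> splits G A -> f A = \sum_i f (G i).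
Proof.
move=> fadd SA [SG tG UG].
have UG' : \bigcup_(k : 'I_#|I|) G (enum_val k) = A.
  rewrite -UG; apply/seteqP; split=> w [i _ Gi]; first by exists (enum_val i).
  by exists (enum_rank i) => //; rewrite enum_rankK.
rewrite -{1}UG' fadd ?UG'//.
  by rewrite [RHS](reindex (@enum_val I I))//=; apply: onW_bij; exact: enum_val_bij.
by move=> k l _ _ /tG kl; apply: enum_val_inj; exact: kl.
Qed.

End Splittings.

(** * The additive hull of a subadditive set function *)

Section PartitionSup.
Context (R : realType) (Omega : Type) (S : set (set Omega)).
Implicit Types (A B : set Omega) (f : set Omega -> \bar R).

Definition finitely_subadditive f := forall (I : finType) (G : I -> set Omega) A,
  S A -> splits S G A -> f A <= \sum_i f (G i).

Definition countably_subadditive f := forall F : nat -> set Omega,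
  (forall i, S (F i)) -> trivIset setT F -> S (\bigcup_i F i) ->
  f (\bigcup_i F i) <= \sum_(i <oo) f (F i).

(** Passing to a common refinement increases the sums of a subadditive
    function, so any two partitions can be compared through their products. *)
Lemma finitely_subadditive_refine_le f (I J : finType) (G : I -> set Omega)
    (H : J -> set Omega) A :
  setI_closed S -> finitely_subadditive f -> splits S G A -> splits S H A ->
  \sum_i f (G i) <= \sum_i \sum_j f (G i `&` H j).
Proof.
move=> SI fsub [SG _ UG] HA; apply: lee_sum => i _; apply: fsub => //.
by apply: splitsI HA _ _ => //; rewrite -UG; exact: bigcup_sup.
Qed.

Variable f : set Omega -> \bar R.
Hypotheses (semiringS : is_semiring_of_sets S).
Hypotheses (f_set0 : f set0 = 0) (f_ge0 : forall A, 0 <= f A).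
Local Notation v := (partition_sup S f).

Lemma partition_sup_ge A : S A -> f A <= v A.
Proof.
move=> SA; apply: le_trans (splits_le_partition_sup f_set0 (splits1 SA)).
by rewrite big_ord1.
Qed.

Lemma partition_sup_ge0 A : S A -> 0 <= v A.
Proof. by move=> SA; apply: le_trans (partition_sup_ge SA). Qed.

(** Since [f] is nonnegative, [v A] is nonnegative when [A] has a finite
    partition in [S] and is [-oo], the supremum of the empty set, otherwise.
    Thus [0 <= v A] is a convenient way to say that [A], possibly outside [S],
    can be partitioned. *)
Lemma partition_sup_ge0_splits A : 0 <= v A ->
  exists (n : nat) (G : 'I_n -> set Omega), splits S G A.
Proof.
move=> vA0; apply: contrapT => nosplit.
suff : v A <= -oo by move=> /(le_trans vA0).
by apply: partition_sup_le => n G GA; exfalso; apply: nosplit; exists n, G.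
Qed.

(** Partitions of [A] and [B] together form one of the union.  Neither set needs
    to be in [S], which is what allows the inductions below to go through unions
    that [S] does not contain. *)
Lemma partition_sup_superD A B : A `&` B = set0 -> v A + v B <= v (A `|` B).
Proof.
move=> AB0.
apply: ge_ereal_supD => [_ [P _ <-]|_ [P _ <-]|_ _ [P AP <-] [Q BQ <-]].
- by rewrite fsume_ge0.
- by rewrite fsume_ge0.
have [n [G [GA ->]]] := partition_splits R AP.
have [m [H [HB ->]]] := partition_splits R BQ.
have /(splits_le_partition_sup f_set0) := splits_sumtype AB0 GA HB.
by rewrite big_sumType.
Qed.

Lemma partition_sup_super_seq (I : choiceType) (F : I -> set Omega) (s : seq I) :
  trivIset [set` s] F -> uniq s ->
  \sum_(i <- s) v (F i) <= v (\bigcup_(i in [set` s]) F i).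
Proof.
have [S0 _ _] := semiringS.
rewrite bigcup_seq; elim: s => [|i s IHs] /=.
  by move=> _ _; rewrite !big_nil partition_sup_ge0.
move=> tF /andP[nis us]; rewrite !big_cons.
have ts : trivIset [set` s] F.
  by apply: sub_trivIset tF => j /= js; rewrite inE js orbT.
apply: le_trans (partition_sup_superD _); first by rewrite leeD2l ?IHs.
rewrite -subset0 -bigcup_seq => w [Fi [j /= js Fj]].
have ij : i = j by apply: tF; rewrite /= ?inE ?eqxx ?js ?orbT//; exists w.
by rewrite ij js in nis.
Qed.

(** Superadditivity does the bookkeeping: [A] minus [B] is the disjoint union of
    the [G i] minus [B], and each of these is a disjoint union of members of [S]
    because [S] is a semi-ring, so [v] is at least a sum of nonnegative terms. *)
Lemma partition_sup_setD_ge0 A B : 0 <= v A -> S B -> 0 <= v (A `\` B).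
Proof.
have [_ _ SD] := semiringS.
move=> /partition_sup_ge0_splits [n [G [SG tG UG]]] SB.
pose H i := G i `\` B.
have tH : trivIset setT H.
  by move=> i j _ _ [w [[Gi _] [Gj _]]]; apply: tG => //; exists w.
have -> : A `\` B = \bigcup_(i in [set` enum 'I_n]) H i.
  rewrite -UG setD_bigcupl; apply/seteqP; split=> w [i _ Hi]; exists i => //=.
  by rewrite mem_enum.
have tHs : trivIset [set` enum 'I_n] H by exact: sub_trivIset tH.
apply: le_trans (partition_sup_super_seq tHs (enum_uniq _)).
apply: sume_ge0 => i _.
have [D [finD DS DE tD]] := SD _ _ (SG i) SB.
have [s us sD] : exists2 s : seq (set Omega), uniq s & [set` s] = D.
  exists (finmap.enum_fset (fset_set D)); first exact: finmap.fset_uniq.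
  by apply/seteqP; split=> X /=; rewrite in_fset_set// inE.
rewrite -sD in DS DE tD; rewrite /H DE.
apply: le_trans (partition_sup_super_seq tD us).
by rewrite big_seq; apply: sume_ge0 => X /DS; exact: partition_sup_ge0.
Qed.

Lemma partition_sup_setD_seq_ge0 (I : choiceType) (F : I -> set Omega) (s : seq I) A :
  0 <= v A -> (forall i, S (F i)) ->
  0 <= v (A `\` \bigcup_(i in [set` s]) F i).
Proof.
move=> vA0 SF; rewrite bigcup_seq; elim: s A vA0 => [|i s IHs] A vA0.
  by rewrite big_nil setD0.
by rewrite big_cons -setDDl; apply/IHs/partition_sup_setD_ge0.
Qed.

(** Superadditivity gives one inequality.  For the other, cut each block of a
    partition of the union along the [F i]: by subadditivity the sum increases,
    and after exchanging the sums the pieces inside [F i] form a partition of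
    [F i]. *)
Lemma partition_sup_additive :
  finitely_subadditive f -> finitely_additive S v.
Proof.
have [_ SI _] := semiringS.
move=> fsub n F SF tF SU; apply/eqP; rewrite eq_le; apply/andP; split; last first.
  rewrite -big_enum (_ : \bigcup_i F i = \bigcup_(i in [set` enum 'I_n]) F i).
    apply: partition_sup_super_seq (enum_uniq _).
    exact: sub_trivIset tF.
  by congr (bigcup _ _); apply/seteqP; split=> i //=; rewrite mem_enum.
have FA : splits S F (\bigcup_i F i) by [].
apply: partition_sup_le => m G GA.
apply: (le_trans (finitely_subadditive_refine_le SI fsub GA FA)).
rewrite exchange_big /=; apply: lee_sum => i _.
under eq_bigr do rewrite setIC.
apply: splits_le_partition_sup => //.
by apply: splitsI GA _ _ => //; exact: bigcup_sup.
Qed.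

(** The upper bound is proved by cutting along the [F i] as in the finite case,
    the exchange of sums being one of nonnegative series.  For the lower bound,
    the union of the first [n] sets need not be in [S], but its complement in
    the whole union has a finite partition, so that [v] is monotone there. *)
Lemma partition_sup_sigma_additive :
  countably_subadditive f -> countably_additive S v.
Proof.
have [_ SI _] := semiringS.
move=> fsub F SF tF SU.
have vF0 i : 0 <= v (F i) by exact: partition_sup_ge0.
have <- : \sum_(i <oo) v (F i) = v (\bigcup_i F i).
  apply/eqP; rewrite eq_le; apply/andP; split.
    apply: lime_le; first exact: is_cvg_nneseries.
    apply: nearW => n.
    have tFs : trivIset [set` index_iota 0 n] F by exact: sub_trivIset tF.
    apply: (le_trans (partition_sup_super_seq tFs (iota_uniq _ _))).
    set U := \bigcup_(i in [set` _]) F i.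
    have -> : \bigcup_i F i = U `|` (\bigcup_i F i `\` U).
      by rewrite setDUK//; exact: bigcup_subset.
    apply: le_trans (partition_sup_superD _); last by rewrite setDIK.
    rewrite leeDl//; apply: partition_sup_setD_seq_ge0 => //.
    exact: partition_sup_ge0.
  apply: partition_sup_le => m G GA; have [SG _ UG] := GA.
  apply: (@le_trans _ _ (\sum_(k < m) \sum_(i <oo) f (G k `&` F i))).
    apply: lee_sum => k _.
    have Gk : \bigcup_i (G k `&` F i) = G k.
      by rewrite -setI_bigcupr -UG; apply/setIidl; exact: bigcup_sup.
    rewrite -{1}Gk; apply: fsub; rewrite ?Gk//.
      by move=> i; exact: SI.
    exact: trivIset_setIl.
  rewrite -nneseries_sum//; apply: lee_nneseries => [i _ _|i _].
    by apply: sume_ge0.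
  under eq_bigr do rewrite setIC.
  apply: splits_le_partition_sup => //.
  by apply: splitsI GA _ _ => //; exact: bigcup_sup.
exact: is_cvg_nneseries.
Qed.

End PartitionSup.

(** * Positive part, negative part and variation *)

Section PositivePart.
Context (R : realType) (Omega : Type) (S : set (set Omega)).
Hypothesis semiringS : is_semiring_of_sets S.
Implicit Types (mu : set Omega -> \bar R) (A : set Omega).

Lemma subadditive_maxe0 mu : finitely_additive S mu ->
  finitely_subadditive S (fun A => maxe (mu A) 0).
Proof.
move=> add I G A SA GA; rewrite ge_max (finitely_additive_splits add SA GA).
apply/andP; split; last by apply: sume_ge0 => i _; rewrite le_max lexx orbT.
by apply: lee_sum => i _; rewrite le_max lexx.
Qed.

(** Compare partial sums and let [n] go to infinity: the series of [mu] may have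
    negative terms but converges by hypothesis, that of the positive parts
    converges because its terms are nonnegative. *)
Lemma countably_subadditive_maxe0 mu : countably_additive S mu ->
  countably_subadditive S (fun A => maxe (mu A) 0).
Proof.
move=> sadd F SF tF SU; have max0 i : 0 <= maxe (mu (F i)) 0.
  by rewrite le_max lexx orbT.
rewrite ge_max nneseries_ge0 ?andbT//.
have cv := sadd F SF tF SU; rewrite -(cvg_lim _ cv)//.
apply: lee_lim; first by apply/cvg_ex; eexists; exact: cv.
  exact: is_cvg_nneseries.
by apply: nearW => n; apply: lee_sum => i _; rewrite le_max lexx.
Qed.

(** This also serves for the negative part, since [charge_neg S mu] is by
    definition [charge_pos S (fun A => - mu A)]. *)
Lemma charge_pos_charge mu : mu set0 = 0 -> finitely_additive S mu ->
  is_charge S (charge_pos S mu).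
Proof.
move=> mu0 add; have [S0 _ _] := semiringS.
have f0 : maxe (mu set0) 0 = 0 by rewrite mu0 maxxx.
have fge0 A : 0 <= maxe (mu A) 0 by rewrite le_max lexx orbT.
have posge0 A : S A -> 0 <= charge_pos S mu A.
  exact: (partition_sup_ge0 f0 fge0).
have posadd : finitely_additive S (charge_pos S mu).
  exact: (partition_sup_additive semiringS f0 fge0 (subadditive_maxe0 add)).
split=> //; split=> //.
(* Additivity for the empty family gives the value at the empty set. *)
- pose F (i : 'I_0) : set Omega := set0.
  have F0 : \bigcup_i F i = set0 by apply/seteqP; split=> w // [].
  by rewrite -F0 posadd ?F0 ?big_ord0// => -[].
- by right=> A /posge0; case: (charge_pos S mu A).
Qed.

Lemma charge_pos_measure mu : mu set0 = 0 -> finitely_additive S mu ->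
  countably_additive S mu -> is_measure S (charge_pos S mu).
Proof.
move=> mu0 add sadd; split; first exact: charge_pos_charge.
apply: partition_sup_sigma_additive => //; first by rewrite mu0 maxxx.
- by move=> A; rewrite le_max lexx orbT.
- exact: countably_subadditive_maxe0.
Qed.

(** Opposite and sum commute in the extended reals only when [+oo] and [-oo] do
    not occur together; the lower bound on [mu] rules this out. *)
Lemma finitely_additiveN mu : (forall A, S A -> -oo < mu A) ->
  finitely_additive S mu -> finitely_additive S (fun A => - mu A).
Proof.
move=> gt add n F SF tF SU; rewrite add// sumeN// => i j _ _.
by apply: ltninfty_adde_def; rewrite inE; exact: gt.
Qed.

Lemma countably_additiveN mu : (forall A, S A -> -oo < mu A) ->
  countably_additive S mu -> countably_additive S (fun A => - mu A).
Proof.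
move=> gt sadd F SF tF SU.
rewrite (_ : (fun n => _) = (fun n => - \sum_(0 <= i < n) mu (F i))).
  by apply: cvgeN; exact: sadd.
apply/funext => n; rewrite sumeN// => i j _ _.
by apply: ltninfty_adde_def; rewrite inE; exact: gt.
Qed.

(** For each partition the two sums differ by [mu A], by additivity; it remains
    to pull the constant [mu A] out of the supremum.  This is legitimate when
    [mu A] is finite, and when [mu A = +oo] both sides are [+oo]. *)
Lemma charge_pos_addE mu A : mu set0 = 0 -> finitely_additive S mu ->
  (forall A, S A -> -oo < mu A) -> S A ->
  charge_pos S mu A = mu A + charge_neg S mu A.
Proof.
move=> mu0 add gt SA.
have fp0 : maxe (mu set0) 0 = 0 by rewrite mu0 maxxx.
have fn0 : maxe (- mu set0) 0 = 0 by rewrite mu0 oppe0 maxxx.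
have sumE n (G : 'I_n -> set Omega) : splits S G A ->
    \sum_i maxe (mu (G i)) 0 = mu A + \sum_i maxe (- mu (G i)) 0.
  move=> GA; rewrite (finitely_additive_splits add SA GA) -big_split /=.
  by apply: eq_bigr => i _; apply/maxe0_addN/gt; case: GA.
apply/eqP; rewrite eq_le; apply/andP; split.
  apply: partition_sup_le => n G GA; rewrite sumE// leeD2l//.
  exact: (splits_le_partition_sup (f := fun C => maxe (- mu C) 0)).
have [muAy|muAy] := eqVneq (mu A) +oo.
  suff -> : charge_pos S mu A = +oo by rewrite leey.
  apply/eqP; rewrite -leye_eq -[leLHS](maxye 0) -muAy.
  apply: (partition_sup_ge (f := fun C => maxe (mu C) 0)) => //.
have muAfin : mu A \is a fin_num.
  by rewrite fin_numE muAy gt_eqF// gt.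
rewrite -leeBrDl//; apply: partition_sup_le => n G GA.
rewrite leeBrDl// -sumE//.
exact: (splits_le_partition_sup (f := fun C => maxe (mu C) 0)).
Qed.

(** Blockwise, [|x|] is the sum of the positive and negative parts of [x].  The
    two suprema on the right may be approached along different partitions, and a
    common refinement does at least as well for both because the positive and
    negative parts are subadditive. *)
Lemma charge_abs_addE mu A : mu set0 = 0 -> finitely_additive S mu ->
  (forall A, S A -> -oo < mu A) -> S A ->
  charge_abs S mu A = charge_pos S mu A + charge_neg S mu A.
Proof.
move=> mu0 add gt SA; have [_ SI _] := semiringS.
have fp0 : maxe (mu set0) 0 = 0 by rewrite mu0 maxxx.
have fn0 : maxe (- mu set0) 0 = 0 by rewrite mu0 oppe0 maxxx.
have fa0 : maxe (mu set0) (- mu set0) = 0 by rewrite mu0 oppe0 maxxx.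
apply/eqP; rewrite eq_le; apply/andP; split.
  apply: partition_sup_le => n G GA.
  under eq_bigr do rewrite maxeN_maxe0.
  rewrite big_split; apply: leeD.
    exact: (splits_le_partition_sup (f := fun C => maxe (mu C) 0)).
  exact: (splits_le_partition_sup (f := fun C => maxe (- mu C) 0)).
apply: ge_ereal_supD => [_ [P _ <-]|_ [P _ <-]|_ _ [P AP <-] [Q AQ <-]].
- by apply: fsume_ge0 => C _; rewrite le_max lexx orbT.
- by apply: fsume_ge0 => C _; rewrite le_max lexx orbT.
have [n [G [GA ->]]] := partition_splits R AP.
have [m [H [HA ->]]] := partition_splits R AQ.
have GHA := splits_refine SI GA HA.
apply: (le_trans _ (splits_le_partition_sup fa0 GHA)).
under [leRHS]eq_bigr do rewrite maxeN_maxe0.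
rewrite big_split; apply: leeD.
- rewrite -(pair_bigA _ (fun i j => maxe (mu (G i `&` H j)) 0)).
  exact: (finitely_subadditive_refine_le SI (subadditive_maxe0 add) GA HA).
- rewrite -(pair_bigA _ (fun i j => maxe (- mu (G i `&` H j)) 0)) exchange_big.
  under [leRHS]eq_bigr do under eq_bigr do rewrite setIC.
  have nsub := subadditive_maxe0 (finitely_additiveN gt add).
  exact: (finitely_subadditive_refine_le SI nsub HA GA).
Qed.

End PositivePart.

Theorem theorem6p3 (R : realType) (Omega : Type) (S : set (set Omega))
    (mu : set Omega -> \bar R)
    (semiringS : is_semiring_of_sets S)
    (signed_charge_mu : is_signed_charge S mu)
    (mu_gtNy : forall A, S A -> -oo < mu A) :
  [/\ is_charge S (charge_pos S mu) /\ is_charge S (charge_neg S mu),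
      forall A, S A -> charge_pos S mu A = mu A + charge_neg S mu A,
      forall A, S A ->
        charge_abs S mu A = charge_pos S mu A + charge_neg S mu A &
      is_signed_measure S mu ->
        is_measure S (charge_pos S mu) /\ is_measure S (charge_neg S mu)].
Proof.
have [mu0 _ add] := signed_charge_mu.
have nmu0 : - mu set0 = 0 by rewrite mu0 oppe0.
have nadd := finitely_additiveN mu_gtNy add.
split.
- by split; exact: charge_pos_charge.
- by move=> A; exact: charge_pos_addE.
- by move=> A; exact: charge_abs_addE.
- move=> [_ sadd]; have nsadd := countably_additiveN mu_gtNy sadd.
  by split; exact: charge_pos_measure.
Qed.
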